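(* Let $(\mathcal G(A,D),p)$ and $(\mathcal G'(A,D),p)$ be two frameworks in $\mathbb R^2$ with the same vertex set $\mathcal V$, the same edge set $\mathcal E$ and the same configuration $p$, and with node bipartitions $\mathcal V=\mathcal V_A\cup\mathcal V_D$ and $\mathcal V=\mathcal V_A'\cup\mathcal V_D'$ respectively. If $\mathcal V_D'=\mathcal V_A$ and $\mathcal V_A'=\mathcal V_D$, then $(\mathcal G(A,D),p)$ is infinitesimally SA-RoD rigid if and only if $(\mathcal G'(A,D),p)$ is infinitesimally SA-RoD rigid.
   Context: Graphs are finite simple undirected with $\mathcal V=\{1,\dots,n\}$, $n\ge 3$. A node bipartition is $\mathcal V=\mathcal V_A\cup\mathcal V_D$ with both parts disjoint and nonempty. A configuration is $p=(p_1^\top,\dots,p_n^\top)^\top\in\mathbb R^{2n}$ with pairwise distinct $p_i\in\mathbb R^2$. $e_{ij}=p_j-p_i$, $b_{ij}=e_{ij}/\|e_{ij}\|$, $\mathcal R(\theta)$ is the counter-clockwise rotation matrix. $\mathcal T_A=\{(u,v,w)\in\mathcal V^3: u\in\mathcal V_A,(u,v),(u,w)\in\mathcal E,v<w\}$, and $\mathcal T_D$ is defined likewise with $u\in\mathcal V_D$. $\alpha_{rst}$ is the counter-clockwise signed angle from $b_{rs}$ to $b_{rt}$; $\kappa_{ijk}=\|e_{ik}\|/\|e_{ij}\|$. The SA-RoD rigidity matrix $R_{\mathcal G(A,D)}(p)$ is the Jacobian of $(\ldots,\alpha_{rst},\ldots,\kappa_{ijk},\ldots)^\top$, $(r,s,t)\in\mathcal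 T_A$, $(i,j,k)\in\mathcal T_D$ (angles differentiated modulo $2\pi$); its rows act on $\delta p$ by $\frac{b_{rs}^\top\mathcal R(\pi/2)}{\|e_{rs}\|}(\delta p_s-\delta p_r)-\frac{b_{rt}^\top\mathcal R(\pi/2)}{\|e_{rt}\|}(\delta p_t-\delta p_r)$ for $(r,s,t)\in\mathcal T_A$ and $\kappa_{ijk}\big[\frac{b_{ik}^\top}{\|e_{ik}\|}(\delta p_k-\delta p_i)-\frac{b_{ij}^\top}{\|e_{ij}\|}(\delta p_j-\delta p_i)\big]$ for $(i,j,k)\in\mathcal T_D$. An infinitesimal SA-RoD motion is a $\delta p\in\mathbb R^{2n}$ with $R_{\mathcal G(A,D)}(p)\delta p=0$; it is trivial if it lies in the span of $\mathbf 1_n\otimes(1,0)^\top$, $\mathbf 1_n\otimes(0,1)^\top$, $(I_n\otimes\mathcal R(\pi/2))p$, $p$. The framework is infinitesimally SA-RoD rigid if all its infinitesimal SA-RoD motions are trivial. *)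

(* Defs.v *)
From mathcomp Require Import all_boot all_order all_algebra.
From mathcomp Require Import all_classical all_reals all_analysis.

Set Implicit Arguments.
Unset Strict Implicit.
Unset Printing Implicit Defensive.

Import Order.TTheory GRing.Theory Num.Theory.
Import numFieldNormedType.Exports.

Local Open Scope ring_scope.

Definition simple_graph (n : nat) (adj : rel 'I_n) : Prop :=
  symmetric adj /\ irreflexive adj.

Definition node_bipartition (n : nat) (VA VD : {set 'I_n}) : Prop :=
  [/\ VA :|: VD = [set: 'I_n], [disjoint VA & VD],
      VA != finset.set0 & VD != finset.set0].

(* The points of the plane and the vectors of R^(2n) are row vectors.  The
   i-th block of size 2 of q : 'rV_(n * 2) is the i-th row of the n x 2 matrix
   vec_mx q; conversely, mxvec stacks the rows of an n x 2 matrix. *)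
Section Plane.
Variable R : realType.

Definition dotv (u v : 'rV[R]_2) : R := (u *m v^T) 0 0.

(* `|u| is the sup norm of a matrix, hence this Euclidean norm. *)
Definition enorm (u : 'rV[R]_2) : R := Num.sqrt (dotv u u).

Definition rotmx (t : R) : 'M[R]_2 :=
  \matrix_(i, j) (if i == j then cos t
                  else if (i < j)%N then - sin t else sin t).

(* The rotation of angle t acts on columns by rotmx t, so on rows by its
   transpose. *)
Definition rotv (t : R) (u : 'rV[R]_2) : 'rV[R]_2 := u *m (rotmx t)^T.

(* Counter-clockwise angle in [0, 2 pi) from the unit vector u to the unit
   vector v. *)
Definition signed_angle (u v : 'rV[R]_2) : R :=
  if 0 <= dotv (rotv (pi / 2) u) v then acos (dotv u v)
  else 2 * pi - acos (dotv u v).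

(* The representative in [-pi, pi) of the class of x modulo 2 pi. *)
Definition mod2pi (x : R) : R :=
  x - 2 * pi * (Num.floor ((x + pi) / (2 * pi)))%:~R.

End Plane.

Section Framework.
Variables (R : realType) (n : nat).
Implicit Types (p q dp : 'rV[R]_(n * 2)) (i j k : 'I_n).

Definition pos q i : 'rV[R]_2 := row i (vec_mx q).

Definition configuration p : Prop := injective (pos p).

Definition edge q i j : 'rV[R]_2 := pos q j - pos q i.

Definition bearing q i j : 'rV[R]_2 := (enorm (edge q i j))^-1 *: edge q i j.

Definition angle q (t : 'I_n * 'I_n * 'I_n) : R :=
  let: (r, s, t) := t in signed_angle (bearing q r s) (bearing q r t).

Definition dist_ratio q (t : 'I_n * 'I_n * 'I_n) : R :=
  let: (i, j, k) := t in enorm (edge q i k) / enorm (edge q i j).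

Variable adj : rel 'I_n.

Definition triples (S : {set 'I_n}) : {set ('I_n * 'I_n * 'I_n)} :=
  [set t | let: (u, v, w) := t in
           [&& u \in S, adj u v, adj u w & (v < w)%N]].

Variables VA VD : {set 'I_n}.

(* The vector of all the angles and ratios of distances.  The angles are
   elements of R / 2 pi Z: the coordinate of q used for an angle is the
   representative in [-pi, pi) of its increment from p to q.  Around p, it
   differs by a constant from any continuous determination of the angle. *)
Definition measurements p q : 'rV[R]_(#|triples VA| + #|triples VD|) :=
  row_mx
    (\row_k mod2pi (angle q (enum_val k) - angle p (enum_val k)))
    (\row_k dist_ratio q (enum_val k)).

(* 'J acts on row vectors on the right: the transpose has one row for each
   measurement. *)
Definition rigidity_matrix p : 'M[R]_(#|triples VA| + #|triples VD|, n * 2) :=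
  ('J (measurements p) p)^T.

Definition inf_motion p dp : Prop := rigidity_matrix p *m dp^T = 0.

(* 1_n (x) u *)
Definition translation (u : 'rV[R]_2) : 'rV[R]_(n * 2) :=
  mxvec (\matrix_(i < n) u).

(* (I_n (x) rotmx t) q *)
Definition rotation (t : R) q : 'rV[R]_(n * 2) :=
  mxvec (\matrix_(i < n) rotv t (pos q i)).

Definition trivial_motions p : {vspace 'rV[R]_(n * 2)} :=
  <<[:: translation (delta_mx 0 0)%R; translation (delta_mx 0 1)%R;
        rotation (pi / 2) p; p]>>%VS.

Definition inf_rigid p : Prop :=
  forall dp, inf_motion p dp -> dp \in trivial_motions p.

End Framework.

(* Main.v *)
(* The key is to rotate each infinitesimal displacement by pi/2.  For a motion
   dp, the angle row of the triple (r, s, t) says that the angular velocities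
   (turn) of the edges rs and rt agree, and the ratio row says, up to a positive
   factor, that their relative elongation rates (stretch) agree.  Rotating all
   the dp_i by pi/2 turns the pair (turn, stretch) of each edge into
   (stretch, - turn), so it maps the motions of one framework to those of the
   other.  It also preserves the trivial motions, and its square is - 1. *)
Require Import Defs.
From HB Require Import structures.
From mathcomp Require Import all_boot all_order all_algebra.
From mathcomp Require Import all_classical all_reals all_analysis.
From mathcomp Require Import ring lra.

Set Implicit Arguments.
Unset Strict Implicit.
Unset Printing Implicit Defensive.

Import Order.TTheory GRing.Theory Num.Theory.
Import numFieldNormedType.Exports.

Local Open Scope ring_scope.

(** * General facts on Fréchet differentials *)

Section Differential.
Variables (R : realType) (V : normedModType R).

(** A differential depends only on the germ at [x]. This allows an angle increment to be
    differentiated through a formula valid only near [p]. *)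
Lemma is_diff_near_eq (W : normedModType R) (f g df : V -> W) (x : V) :
  (\near x, f x = g x) -> is_diff x f df -> is_diff x g df.
Proof.
move=> fg [dfx <-].
have fgx : f x = g x by apply: nbhs_singleton fg.
have [cdf /eqaddoP fo] := (diff_locallyP x f).1 dfx.
(* The first-order expansion of [f] is also one of [g]; uniqueness of the differential then
   identifies ['d g x] with ['d f x]. *)
have go : g \o shift x = cst (g x) + 'd f x +o_ 0 id.
  apply/eqaddoP => e e0; have := fo e e0; rewrite -fgx.
  have : \forall h \near 0, f (x + h) = g (x + h).
    exact: (nbhs0P (fun y => f y = g y) x).1 fg.
  move=> nfg nfo; apply: filterS2 nfg nfo => h fgh; rewrite !fctE /=.
  by rewrite (addrC h x) fgh.
have dg := diff_unique cdf go.
apply: DiffDef; last exact: dg.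
by apply/diff_locallyP; rewrite dg.
Qed.

(** A coordinate is linear and continuous, hence its own differential; the linear structure is
    packed by hand. *)
Lemma is_diff_coord m n (M : 'M[R]_(m, n)) i j :
  is_diff M (fun N : 'M[R]_(m, n) => N i j : R) (fun N : 'M[R]_(m, n) => N i j).
Proof.
have lin : linear (fun N : 'M[R]_(m, n) => N i j : R).
  by move=> a A B; rewrite !mxE.
pose linM := GRing.isLinear.Build _ _ _ _ _ lin.
pose f : {linear 'M[R]_(m, n) -> R} :=
  HB.pack (fun N : 'M[R]_(m, n) => N i j) linM.
apply: DiffDef; first exact: differentiable_coord.
exact: (@diff_lin _ _ _ f M (@coord_continuous _ _ _ _ _)).
Qed.

Lemma is_diff_row m (f df : V -> 'rV[R]_m) (x : V) :
  (forall k, is_diff x (fun q => f q 0 k : R) (fun v => df v 0 k)) ->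
  is_diff x f df.
Proof.
move=> fk.
have dfx : differentiable f x.
  have -> : f = \sum_(k < m) (fun q => f q 0 k *: delta_mx 0 k).
    by apply/funext => q; rewrite fct_sumE [LHS]row_sum_delta.
  by apply: differentiable_sum => k; apply: differentiableZl; exact: ex_diff.
apply: DiffDef => //; apply/funext => v; apply/rowP => k.
have -> : df v 0 k = 'd (fun q => f q 0 k : R) x v.
  by rewrite (@diff_val _ _ _ _ _ _ _ (fk k)).
have ck := is_diff_coord (f x) 0 k.
rewrite (@diff_comp _ _ _ _ f (fun N : 'rV[R]_m => N 0 k : R) x)//=.
by rewrite diff_val.
Qed.

Lemma is_diff_comp_derive (f df : V -> R) (g : R -> R) (a : R) (x : V) :
  is_diff x f df -> is_derive (f x) 1 g a ->
  is_diff x (g \o f) (fun v => df v * a).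
Proof.
move=> fx [gx <-].
have dg : differentiable g (f x) by apply/derivable1_diffP.
apply: DiffDef; first exact: differentiable_comp.
rewrite diff_comp//= diff1E// diff_val.
by apply/funext => v /=; rewrite derive1E.
Qed.

End Differential.

(** * Representatives of angles modulo 2 pi *)

Section Trigo.
Variable R : realType.

Lemma periodicz (U V : zmodType) (f : U -> V) (T : U) :
  periodic f T -> forall (m : int) a, f (a + T *~ m) = f a.
Proof.
move=> fT [] n a; first by rewrite -pmulrn periodicn.
rewrite NegzE mulrNz -pmulrn.
by rewrite -[LHS](periodicn fT n.+1) subrK.
Qed.

Lemma mod2piE (x : R) :
  mod2pi x = x + (pi *+ 2) *~ (- Num.floor ((x + pi) / (2 * pi))).
Proof. by rewrite /mod2pi mulrNz mulrzr mulr_natl. Qed.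

Lemma cos_mod2pi (x : R) : cos (mod2pi x) = cos x.
Proof. by rewrite mod2piE periodicz//; exact: cosD2pi. Qed.

Lemma sin_mod2pi (x : R) : sin (mod2pi x) = sin x.
Proof. by rewrite mod2piE periodicz//; exact: sinD2pi. Qed.

Lemma mod2pi_itv (x : R) : - pi <= mod2pi x < pi.
Proof.
have pi0 := pi_gt0 R.
rewrite /mod2pi; set y := (x + pi) / (2 * pi).
have xE : x = 2 * pi * y - pi.
  by rewrite /y mulrC divfK ?addrK// mulf_neq0 ?gt_eqF.
have /andP[] := floor_itv y.
rewrite intrD => h1 h2.
rewrite [X in _ <= X - _]xE [X in _ && (X - _ < _)]xE.
by apply/andP; split; nra.
Qed.

(** Within [-pi, pi), a positive cosine forces the representative into ]-pi/2, pi/2[, where [atan]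
    inverts [tan]. Outside that interval a shift by pi/2 gives a nonnegative sine, hence a
    nonpositive cosine. *)
Lemma mod2pi_atan (x : R) : 0 < cos x -> mod2pi x = atan (sin x / cos x).
Proof.
rewrite -cos_mod2pi -sin_mod2pi => cos_gt0.
have /andP[ylo yhi] := mod2pi_itv x.
have pi0 := pi_gt0 R.
rewrite -/(tan _) tanK// in_itv/=; apply/andP; split.
  rewrite ltNge; apply/negP => y_le.
  have : 0 <= sin (- mod2pi x - pi / 2) by apply: sin_ge0_pi; lra.
  by rewrite sinBpihalf cosN oppr_ge0 leNgt cos_gt0.
rewrite ltNge; apply/negP => y_ge.
have : 0 <= sin (mod2pi x - pi / 2) by apply: sin_ge0_pi; lra.
by rewrite sinBpihalf oppr_ge0 leNgt cos_gt0.
Qed.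

End Trigo.

Lemma ord2P (i : 'I_2) : i = 0 \/ i = 1.
Proof. by case: i => -[|[|//]] Hi; [left|right]; apply/val_inj. Qed.

(** * Dot and cross products, quarter turns and signed angles in the plane *)

Section PlaneVectors.
Variable R : realType.
Implicit Types u v : 'rV[R]_2.

Definition crossv u v : R := u 0 0 * v 0 1 - u 0 1 * v 0 0.

Lemma dotvE u v : dotv u v = u 0 0 * v 0 0 + u 0 1 * v 0 1.
Proof.
rewrite /dotv mxE !big_ord_recl big_ord0 addr0 !mxE.
by rewrite (_ : lift ord0 ord0 = 1) //; apply/val_inj.
Qed.

Lemma rotv_pihalf0 u : rotv (pi / 2) u 0 0 = - u 0 1.
Proof.
rewrite /rotv mxE !big_ord_recl big_ord0 addr0 !mxE /=.
rewrite (_ : lift ord0 ord0 = 1) //; last by apply/val_inj.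
by rewrite cos_pihalf sin_pihalf mulr0 add0r mulrN1.
Qed.

Lemma rotv_pihalf1 u : rotv (pi / 2) u 0 1 = u 0 0.
Proof.
rewrite /rotv mxE !big_ord_recl big_ord0 addr0 !mxE /=.
rewrite (_ : lift ord0 ord0 = 1) //; last by apply/val_inj.
by rewrite cos_pihalf sin_pihalf mulr0 addr0 mulr1.
Qed.

Lemma dotv_rotl u v : dotv (rotv (pi / 2) u) v = crossv u v.
Proof. by rewrite dotvE rotv_pihalf0 rotv_pihalf1 /crossv; ring. Qed.

Lemma dotv_rotr u v : dotv u (rotv (pi / 2) v) = - crossv u v.
Proof. by rewrite dotvE rotv_pihalf0 rotv_pihalf1 /crossv; ring. Qed.

Lemma crossv_rotr u v : crossv u (rotv (pi / 2) v) = dotv u v.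
Proof. by rewrite dotvE /crossv rotv_pihalf0 rotv_pihalf1; ring. Qed.

Lemma rotv_pihalfK u : rotv (pi / 2) (rotv (pi / 2) u) = - u.
Proof.
apply/rowP => i; rewrite [RHS]mxE.
have [->|->] := ord2P i.
- by rewrite rotv_pihalf0 rotv_pihalf1.
- by rewrite rotv_pihalf1 rotv_pihalf0.
Qed.

Lemma dotvv_ge0 u : 0 <= dotv u u.
Proof. by rewrite dotvE addr_ge0// -expr2 sqr_ge0. Qed.

Lemma dotvv_eq0 u : (dotv u u == 0) = (u == 0).
Proof.
rewrite dotvE -!expr2 paddr_eq0 ?sqr_ge0// !sqrf_eq0.
apply/andP/eqP => [[/eqP u0 /eqP u1]|->]; last by rewrite !mxE.
apply/rowP => i; rewrite [RHS]mxE.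
by case: (ord2P i) => ->.
Qed.

Lemma dotvv_gt0 u : (0 < dotv u u) = (u != 0).
Proof. by rewrite lt0r dotvv_ge0 andbT dotvv_eq0. Qed.

Lemma enorm_gt0 u : (0 < enorm u) = (u != 0).
Proof. by rewrite sqrtr_gt0 dotvv_gt0. Qed.

Lemma sqr_enorm u : enorm u ^+ 2 = dotv u u.
Proof. exact/sqr_sqrtr/dotvv_ge0. Qed.

Lemma dotvZ a b u v : dotv (a *: u) (b *: v) = a * b * dotv u v.
Proof. by rewrite !dotvE !mxE; ring. Qed.

Lemma crossvZ a b u v : crossv (a *: u) (b *: v) = a * b * crossv u v.
Proof. by rewrite /crossv !mxE; ring. Qed.

(** Lagrange's identity. *)
Lemma dotv_crossv_sqr u v :
  dotv u v ^+ 2 + crossv u v ^+ 2 = dotv u u * dotv v v.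
Proof. by rewrite /crossv !dotvE; ring. Qed.

(** For unit vectors, Lagrange's identity makes the sine of [acos (dotv u v)] equal to the absolute
    value of the cross product; the case split in [signed_angle] restores its sign. *)
Lemma signed_angleP u v : dotv u u = 1 -> dotv v v = 1 ->
  cos (signed_angle u v) = dotv u v /\ sin (signed_angle u v) = crossv u v.
Proof.
move=> u1 v1; have := dotv_crossv_sqr u v; rewrite u1 v1 mulr1 => lag.
have d_itv : -1 <= dotv u v <= 1 by have := sqr_ge0 (crossv u v); nra.
have cosa : cos (acos (dotv u v)) = dotv u v by rewrite acosK// in_itv.
have sina : sin (acos (dotv u v)) = `|crossv u v|.
  by rewrite sin_acos// -sqrtr_sqr; congr Num.sqrt; lra.
rewrite /signed_angle dotv_rotl; case: ifPn => [x_ge0|].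
  by rewrite cosa sina ger0_norm.
rewrite -ltNge => x_lt0; rewrite mulr_natl addrC cosD2pi sinD2pi.
by rewrite cosN sinN cosa sina ltr0_norm// opprK.
Qed.

End PlaneVectors.

(** * Differentials of quotients, plane products and the Euclidean norm *)

Section DifferentialPlane.
Variables (R : realType) (V : normedModType R).

Lemma is_diff_div (f df g dg : V -> R) (x : V) :
  is_diff x f df -> is_diff x g dg -> g x != 0 ->
  is_diff x (fun q => f q / g q)
    (fun v => (df v * g x - f x * dg v) / g x ^+ 2).
Proof.
move=> fx gx gn0.
have gVx : is_diff x (fun q => (g q)^-1) (fun v => - (g x) ^- 2 * dg v).
  by apply: DiffDef; [exact: differentiableV|rewrite diffV// diff_val].
apply: (is_diff_eq (is_diffM fx gVx)); apply/funext => v.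
by rewrite !fctE /= /GRing.scale /=; field.
Qed.

Variables (f df g dg : V -> 'rV[R]_2) (x : V).
Hypotheses (fx : is_diff x f df) (gx : is_diff x g dg).

Let is_diff_fcoord i : is_diff x (fun q => f q 0 i : R) (fun v => df v 0 i).
Proof.
exact: (is_diff_comp fx (is_diff_coord (f x) 0 i)).
Qed.

Let is_diff_gcoord i : is_diff x (fun q => g q 0 i : R) (fun v => dg v 0 i).
Proof.
exact: (is_diff_comp gx (is_diff_coord (g x) 0 i)).
Qed.

Lemma is_diff_dotv :
  is_diff x (fun q => dotv (f q) (g q))
    (fun v => dotv (df v) (g x) + dotv (f x) (dg v)).
Proof.
rewrite (_ : (fun q => _) = (fun q => f q 0 0) * (fun q => g q 0 0) +
    (fun q => f q 0 1) * (fun q => g q 0 1)); last first.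
  by apply/funext => q; rewrite dotvE.
have fg i := is_diffM (is_diff_fcoord i) (is_diff_gcoord i).
apply: (is_diff_eq (is_diffD (fg 0) (fg 1))); apply/funext => v.
by rewrite !fctE /= /GRing.scale /= !dotvE; ring.
Qed.

Lemma is_diff_crossv :
  is_diff x (fun q => crossv (f q) (g q))
    (fun v => crossv (df v) (g x) + crossv (f x) (dg v)).
Proof.
have fg i j := is_diffM (is_diff_fcoord i) (is_diff_gcoord j).
apply: (is_diff_eq (is_diffB (fg 0 1) (fg 1 0))); apply/funext => v.
by rewrite !fctE /= /GRing.scale /= /crossv; ring.
Qed.

End DifferentialPlane.

Lemma is_diff_enorm (R : realType) (V : normedModType R)
    (f df : V -> 'rV[R]_2) (x : V) :
  is_diff x f df -> f x != 0 ->
  is_diff x (fun q => enorm (f q)) (fun v => dotv (f x) (df v) / enorm (f x)).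
Proof.
move=> fx fx0.
have dd := is_diff_dotv fx fx.
have ds : is_derive (dotv (f x) (f x)) 1 Num.sqrt (2 * enorm (f x))^-1.
  by apply: is_derive1_sqrt; rewrite dotvv_gt0.
apply: (is_diff_eq (is_diff_comp_derive dd ds)); apply/funext => v.
have en0 : enorm (f x) != 0 by rewrite gt_eqF// enorm_gt0.
by rewrite !dotvE; field.
Qed.

(** * Differentials of the angles and of the ratios of distances *)

Section Measurements.
Variables (R : realType) (n : nat).
Implicit Types (p q dp : 'rV[R]_(n * 2)) (i j k : 'I_n).

Lemma posE q i a : pos q i 0 a = q 0 (mxvec_index i a).
Proof. by rewrite /pos !mxE. Qed.

Lemma edgeE q i j a :
  edge q i j 0 a = q 0 (mxvec_index j a) - q 0 (mxvec_index i a).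
Proof. by rewrite mxE posE mxE posE. Qed.

Lemma is_diff_edge p i j :
  is_diff p (fun q => edge q i j) (fun v => edge v i j).
Proof.
apply: is_diff_row => a.
have e := is_diffB (is_diff_coord p 0 (mxvec_index j a))
  (is_diff_coord p 0 (mxvec_index i a)).
rewrite [X in is_diff_def _ X _](_ : _ =
  (fun q : 'rV_(n * 2) => q 0 (mxvec_index j a)) -
  (fun q : 'rV_(n * 2) => q 0 (mxvec_index i a))); last first.
  by apply/funext => q; rewrite edgeE.
by apply: (is_diff_eq e); apply/funext => v; rewrite edgeE.
Qed.

Lemma edge_neq0 p i j : configuration p -> i != j -> edge p i j != 0.
Proof.
by move=> pinj ij; rewrite subr_eq0 eq_sym; apply: contra ij => /eqP /pinj ->.
Qed.

(** With the plane identified with the complex numbers, [turn] and [stretch] are the imaginary and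
    real parts of the quotient of [edge dp i j] by [edge p i j]. *)
Definition turn p dp i j : R :=
  crossv (edge p i j) (edge dp i j) / dotv (edge p i j) (edge p i j).

Definition stretch p dp i j : R :=
  dotv (edge p i j) (edge dp i j) / dotv (edge p i j) (edge p i j).

Lemma dotv_bearing q i j k l :
  dotv (bearing q i j) (bearing q k l) =
  dotv (edge q i j) (edge q k l) / (enorm (edge q i j) * enorm (edge q k l)).
Proof. by rewrite dotvZ -invfM mulrC. Qed.

Lemma crossv_bearing q i j k l :
  crossv (bearing q i j) (bearing q k l) =
  crossv (edge q i j) (edge q k l) / (enorm (edge q i j) * enorm (edge q k l)).
Proof. by rewrite crossvZ -invfM mulrC. Qed.

Lemma dotv_bearing1 q i j : edge q i j != 0 ->
  dotv (bearing q i j) (bearing q i j) = 1.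
Proof.
move=> e0; rewrite dotv_bearing -expr2 sqr_enorm divff//.
by rewrite dotvv_eq0.
Qed.

(* With z q := d q + i (x q), a positive multiple of exp(i (angle q)), the angle
   increment is the argument of conj(z p) * z q; it lies in ]- pi/2, pi/2[ as
   soon as the real part of this product is positive. *)
Lemma angle_increment p q r s t :
  let d q := dotv (edge q r s) (edge q r t) in
  let x q := crossv (edge q r s) (edge q r t) in
  edge p r s != 0 -> edge p r t != 0 -> 0 < d p * d q + x p * x q ->
  mod2pi (angle q (r, s, t) - angle p (r, s, t)) =
  atan ((d p * x q - x p * d q) / (d p * d q + x p * x q)).
Proof.
move=> d x ps0 pt0 c_gt0.
(* A zero edge of [q] would make both [d q] and [x q] vanish, against the positivity assumption. *)
have qs0 : edge q r s != 0.
  apply: contraTneq c_gt0; rewrite /d /x !dotvE /crossv => ->.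
  by rewrite ![(0 : 'rV_2) 0 _]mxE !(mul0r, mulr0, addr0, subr0) ltxx.
have qt0 : edge q r t != 0.
  apply: contraTneq c_gt0; rewrite /d /x !dotvE /crossv => ->.
  by rewrite ![(0 : 'rV_2) 0 _]mxE !(mul0r, mulr0, addr0, subr0) ltxx.
have [cp sp] := signed_angleP (dotv_bearing1 ps0) (dotv_bearing1 pt0).
have [cq sq] := signed_angleP (dotv_bearing1 qs0) (dotv_bearing1 qt0).
rewrite !dotv_bearing !crossv_bearing in cp sp cq sq.
set Np := enorm (edge p r s) * enorm (edge p r t) in cp sp.
set Nq := enorm (edge q r s) * enorm (edge q r t) in cq sq.
have Np0 : 0 < Np by rewrite mulr_gt0// enorm_gt0.
have Nq0 : 0 < Nq by rewrite mulr_gt0// enorm_gt0.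
have cosE : cos (angle q (r, s, t) - angle p (r, s, t)) =
    (d p * d q + x p * x q) / (Np * Nq).
  rewrite cosB /angle cp cq sp sq -/(d p) -/(d q) -/(x p) -/(x q).
  by field; rewrite !gt_eqF.
have sinE : sin (angle q (r, s, t) - angle p (r, s, t)) =
    (d p * x q - x p * d q) / (Np * Nq).
  rewrite sinB /angle cp cq sp sq -/(d p) -/(d q) -/(x p) -/(x q).
  by field; rewrite !gt_eqF.
rewrite mod2pi_atan; last by rewrite cosE divr_gt0// mulr_gt0.
by rewrite cosE sinE; congr atan; field; rewrite !gt_eqF.
Qed.

(** Near [p] the increment is the [atan] of a quotient whose numerator vanishes at [p], so its
    differential is that of the numerator divided by the denominator at [p]. *)
Lemma is_diff_angle p r s t : edge p r s != 0 -> edge p r t != 0 ->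
  is_diff p (fun q => mod2pi (angle q (r, s, t) - angle p (r, s, t)))
    (fun dp => turn p dp r t - turn p dp r s).
Proof.
move=> ps0 pt0.
pose d q := dotv (edge q r s) (edge q r t).
pose x q := crossv (edge q r s) (edge q r t).
pose d' v := dotv (edge v r s) (edge p r t) + dotv (edge p r s) (edge v r t).
pose x' v :=
  crossv (edge v r s) (edge p r t) + crossv (edge p r s) (edge v r t).
have dd : is_diff p d d'.
  exact: is_diff_dotv (is_diff_edge p r s) (is_diff_edge p r t).
have dx : is_diff p x x'.
  exact: is_diff_crossv (is_diff_edge p r s) (is_diff_edge p r t).
have dc : is_diff p (fun q => d p * d q + x p * x q)
    (fun v => d p * d' v + x p * x' v).
  exact: is_diffD (is_diffZ (d p) dd) (is_diffZ (x p) dx).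
have ds : is_diff p (fun q => d p * x q - x p * d q)
    (fun v => d p * x' v - x p * d' v).
  exact: is_diffB (is_diffZ (d p) dx) (is_diffZ (x p) dd).
have dps : 0 < dotv (edge p r s) (edge p r s) by rewrite dotvv_gt0.
have dpt : 0 < dotv (edge p r t) (edge p r t) by rewrite dotvv_gt0.
have c_gt0 : 0 < d p * d p + x p * x p.
  by rewrite -!expr2 dotv_crossv_sqr mulr_gt0.
have cn0 : d p * d p + x p * x p != 0 by rewrite gt_eqF.
have dsc := is_diff_div ds dc cn0.
have dat := is_diff_comp_derive dsc (is_derive1_atan _).
(* The denominator is positive at [p], hence around [p] by continuity, and there the [atan] formula
   is valid. *)
apply: (is_diff_near_eq _ (is_diff_eq dat _)).
  have cc := differentiable_continuous (@ex_diff _ _ _ _ _ _ _ dc).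
  have : \forall q \near p, 0 < d p * d q + x p * x q.
    exact: (cvgr_gt _ cc).
  by apply: filterS => q cq; rewrite angle_increment.
apply/funext => v /=.
(* The argument of [atan] is 0 at [p], where its derivative is 1. Lagrange's identity then turns the
   remaining denominator into the product of the squared edge lengths. *)
have s0 : d p * x p - x p * d p = 0 by ring.
rewrite !s0 !mul0r subr0 expr0n /= addr0 invr1 mulr1 /turn.
rewrite -!expr2 dotv_crossv_sqr /d' /x' /d /x !dotvE /crossv.
rewrite !dotvE in dps dpt.
by field; rewrite !gt_eqF.
Qed.

(** This is logarithmic differentiation: [stretch] is the logarithmic derivative of an edge
    length. *)
Lemma is_diff_dist_ratio p i j k : edge p i j != 0 -> edge p i k != 0 ->
  is_diff p (fun q => dist_ratio q (i, j, k))
    (fun dp => dist_ratio p (i, j, k) * (stretch p dp i k - stretch p dp i j)).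
Proof.
move=> pj0 pk0.
have dj := is_diff_enorm (is_diff_edge p i j) pj0.
have dk := is_diff_enorm (is_diff_edge p i k) pk0.
have nj : enorm (edge p i j) != 0 by rewrite gt_eqF// enorm_gt0.
have nk : enorm (edge p i k) != 0 by rewrite gt_eqF// enorm_gt0.
apply: (is_diff_eq (is_diff_div dk dj nj)); apply/funext => v.
rewrite /stretch /dist_ratio -!sqr_enorm; field.
by rewrite nj nk.
Qed.

End Measurements.

(** * Infinitesimal motions as conditions on [turn] and [stretch] *)

Section InfinitesimalMotions.
Variables (R : realType) (n : nat) (adj : rel 'I_n).
Hypothesis adj_graph : simple_graph adj.
Implicit Types (p q dp : 'rV[R]_(n * 2)) (i j k : 'I_n) (S VA VD : {set 'I_n}).

Lemma mem_triples S i j k :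
  ((i, j, k) \in triples adj S) = [&& i \in S, adj i j, adj i k & (j < k)%N].
Proof. by rewrite inE. Qed.

Lemma triples_edge_neq0 p S i j k : configuration p ->
  (i, j, k) \in triples adj S -> edge p i j != 0 /\ edge p i k != 0.
Proof.
have [_ irr] := adj_graph.
move=> p_conf; rewrite mem_triples => /and4P[_ ij ik _].
by split; apply: edge_neq0 => //; apply: contraTneq isT => e;
  [rewrite -e irr in ij|rewrite -e irr in ik].
Qed.

Definition measurement_diff VA VD p dp :
    'rV[R]_(#|triples adj VA| + #|triples adj VD|) :=
  row_mx
    (\row_l let: (r, s, t) := enum_val l in turn p dp r t - turn p dp r s)
    (\row_l let: (i, j, k) := enum_val l in
      dist_ratio p (i, j, k) * (stretch p dp i k - stretch p dp i j)).

Lemma is_diff_measurements VA VD p : configuration p ->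
  is_diff p (measurements adj VA VD p) (measurement_diff VA VD p).
Proof.
move=> p_conf; apply: is_diff_row => l.
rewrite /measurements /measurement_diff.
case: (splitP l) => m lE.
  have -> : l = lshift _ m by apply/val_inj.
  under eq_fun do rewrite row_mxEl mxE.
  under [X in is_diff_def _ _ X]eq_fun do rewrite row_mxEl mxE.
  case: (enum_val m) (enum_valP m) => [[r s] t] /(triples_edge_neq0 p_conf)[].
  exact: is_diff_angle.
have -> : l = rshift _ m by apply/val_inj.
under eq_fun do rewrite row_mxEr mxE.
under [X in is_diff_def _ _ X]eq_fun do rewrite row_mxEr mxE.
case: (enum_val m) (enum_valP m) => [[i j] k] /(triples_edge_neq0 p_conf)[].
exact: is_diff_dist_ratio.
Qed.

(** The rigidity matrix is a transposed Jacobian, so its product with [dp^T] is the transpose of the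
    differential of [measurements] at [p], applied to [dp]. *)
Lemma inf_motionE VA VD p dp : configuration p ->
  inf_motion adj VA VD p dp <-> measurement_diff VA VD p dp = 0.
Proof.
move=> p_conf; have d := is_diff_measurements VA VD p_conf.
rewrite /inf_motion /rigidity_matrix -trmx_mul /jacobian mul_rV_lin1 diff_val.
split=> [/(congr1 trmx)|->]; last by rewrite trmx0.
by rewrite trmxK trmx0.
Qed.

Definition const_on_edges S (f : 'I_n -> 'I_n -> R) :=
  forall i j k, i \in S -> adj i j -> adj i k -> f i j = f i k.

(** The order [j < k] imposed in [triples] loses nothing: the equality is symmetric in [j] and [k],
    and trivial when they coincide. *)
Lemma const_on_edgesP S f : const_on_edges S f <->
  forall i j k, (i, j, k) \in triples adj S -> f i k - f i j = 0.
Proof.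
split=> [fS i j k|fS i j k iS ij ik].
  by rewrite mem_triples => /and4P[iS ij ik _]; rewrite (fS i j k) ?subrr.
case: (ltngtP j k) => [jk|kj|/val_inj -> //]; last apply/esym.
all: by apply/eqP; rewrite eq_sym -subr_eq0; apply/eqP/fS;
  rewrite mem_triples iS ij ik.
Qed.

Lemma inf_motionP VA VD p dp : configuration p ->
  inf_motion adj VA VD p dp <->
  const_on_edges VA (turn p dp) /\ const_on_edges VD (stretch p dp).
Proof.
move=> p_conf; rewrite (inf_motionE _ _ _ p_conf) !const_on_edgesP.
split=> [/eqP|[tA sD]].
  rewrite /measurement_diff -row_mx0 => /eqP/eq_row_mx[/rowP tA /rowP sD].
  split=> i j k ijk.
    by have := tA (enum_rank_in ijk (i, j, k)); rewrite !mxE enum_rankK_in.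
  have := sD (enum_rank_in ijk (i, j, k)); rewrite !mxE enum_rankK_in//.
  (* The factor [dist_ratio] is a quotient of positive lengths, so it can be cancelled. *)
  have [ij0 ik0] := triples_edge_neq0 p_conf ijk.
  move/eqP; rewrite mulf_eq0 => /orP[|/eqP//].
  by rewrite gt_eqF// divr_gt0// enorm_gt0.
rewrite /measurement_diff -row_mx0; congr row_mx; apply/rowP => l; rewrite !mxE.
  by case: (enum_val l) (enum_valP l) => [[r s] t] /tA.
by case: (enum_val l) (enum_valP l) => [[i j] k] /sD ->; rewrite mulr0.
Qed.

(** * Action of the quarter turn on motions and on trivial motions *)

Lemma pos_rotation q t i : pos (rotation t q) i = rotv t (pos q i).
Proof. by rewrite /pos /rotation mxvecK rowK. Qed.

Lemma eq_from_pos q1 q2 : (forall i, pos q1 i = pos q2 i) -> q1 = q2.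
Proof.
move=> e; rewrite -[q1]vec_mxK -[q2]vec_mxK; congr mxvec.
by apply/row_matrixP => i; exact: e.
Qed.

Lemma edge_rotation q t i j : edge (rotation t q) i j = rotv t (edge q i j).
Proof. by rewrite /edge !pos_rotation /rotv mulmxBl. Qed.

Lemma posN q i : pos (- q) i = - pos q i.
Proof. by rewrite /pos !linearN. Qed.

Lemma rotation_pihalfK q : rotation (pi / 2) (rotation (pi / 2) q) = - q.
Proof. by apply: eq_from_pos => i; rewrite !pos_rotation rotv_pihalfK posN. Qed.

Lemma rotation_translation t (u : 'rV[R]_2) :
  rotation t (translation n u) = translation n (rotv t u).
Proof.
by apply: eq_from_pos => i; rewrite pos_rotation /pos !mxvecK !rowK.
Qed.

Lemma turn_rotation p dp i j :
  turn p (rotation (pi / 2) dp) i j = stretch p dp i j.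
Proof. by rewrite /turn edge_rotation crossv_rotr. Qed.

Lemma stretch_rotation p dp i j :
  stretch p (rotation (pi / 2) dp) i j = - turn p dp i j.
Proof. by rewrite /stretch edge_rotation dotv_rotr mulNr. Qed.

Lemma inf_motion_rotation VA VD p dp : configuration p ->
  inf_motion adj VA VD p dp -> inf_motion adj VD VA p (rotation (pi / 2) dp).
Proof.
move=> p_conf /(inf_motionP _ _ _ p_conf)[tA sD].
apply/(inf_motionP _ _ _ p_conf); split=> i j k iS ij ik.
  by rewrite !turn_rotation; exact: sD.
by rewrite !stretch_rotation; congr (- _); exact: tA.
Qed.

(** A composite of bundled linear maps, from which [linfun] can build an endomorphism. *)
Lemma rotationE t q :
  rotation t q = (mxvec \o mulmxr (rotmx t)^T \o vec_mx) q.
Proof.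
by apply: eq_from_pos => i; rewrite pos_rotation /pos /= mxvecK row_mul.
Qed.

(** The quarter turn permutes the four generators up to sign: it exchanges the two translations, and
    [p] with its rotation. By linearity it preserves their span. *)
Lemma trivial_motions_rotation p dp :
  dp \in trivial_motions p -> rotation (pi / 2) dp \in trivial_motions p.
Proof.
pose T := trivial_motions p.
have rot_delta0 : rotv (pi / 2) (delta_mx 0 0) = delta_mx 0 1 :> 'rV[R]_2.
  by apply/rowP => i; case: (ord2P i) => ->;
    rewrite ?rotv_pihalf0 ?rotv_pihalf1 !mxE ?oppr0.
pose rot := linfun (mxvec \o mulmxr (rotmx (pi / 2 : R))^T \o vec_mx
  : 'rV[R]_(n * 2) -> 'rV[R]_(n * 2)).
have rotE q : rot q = rotation (pi / 2) q by rewrite lfunE rotationE.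
have TX : {subset [:: translation n (delta_mx 0 0);
    translation n (delta_mx 0 1); rotation (pi / 2) p; p] <= T} by move=> q; exact: memv_span.
suff sT : (rot @: T <= T)%VS.
  by move=> dpT; rewrite -rotE; apply: (subvP sT); exact: memv_img.
rewrite limg_span; apply/span_subvP => q /=.
rewrite !inE !rotE rotation_pihalfK.
(* The second translation is written as the quarter turn of the first, so that its own image becomes
   the opposite of the first. *)
rewrite -rot_delta0 -!rotation_translation !rotation_pihalfK.
rewrite rotation_translation rot_delta0.
by case/or4P => /eqP ->; rewrite ?memvN; apply: TX; rewrite !inE eqxx ?orbT.
Qed.

(** A motion of the swapped framework turns into a motion of the rigid one, which is trivial; a
    second quarter turn gives that [- dp] is trivial. *)
Lemma inf_rigid_swap VA VD p : configuration p ->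
  inf_rigid adj VA VD p -> inf_rigid adj VD VA p.
Proof.
move=> p_conf rig dp /(inf_motion_rotation p_conf)/rig.
by move=> /trivial_motions_rotation; rewrite rotation_pihalfK memvN.
Qed.

End InfinitesimalMotions.

Theorem corollary1 (R : realType) (n : nat) (n_ge3 : (3 <= n)%N)
    (adj : rel 'I_n) (adj_graph : simple_graph adj)
    (p : 'rV[R]_(n * 2)) (p_conf : configuration p)
    (VA VD VA' VD' : {set 'I_n})
    (bip : node_bipartition VA VD) (bip' : node_bipartition VA' VD')
    (eqD : VD' = VA) (eqA : VA' = VD) :
  inf_rigid adj VA VD p <-> inf_rigid adj VA' VD' p.
Proof. by rewrite eqA eqD; split; exact: inf_rigid_swap. Qed.
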